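(* Assume $\langle f\rangle_X=0$ and that $\psi$ satisfies (A1) and (A2). Let $u^0$ be the solution of the homogenized problem and $u^H$ the solution of the HQC problem. Then there exist constants $C_4,C_5$, depending only on $c_\psi,C_\psi,C'_\psi$ and $p$ (independent of $\epsilon$, $H$ and $f$), such that \[ |u^H-u^0|_{H^1}\le C_4 H\|f\|_{L^2},\qquad \|u^H-u^0\|_{L^2}\le C_5H^2\|f\|_{L^2}+\|e_{\rm mod}\|_{L^2}. \]
   Context: Let $\epsilon>0$, $N,p$ positive integers with normalization $N\epsilon=1$; $X_i=\epsilon i$, $Y_j=j$. $U^N_{\rm per}(\epsilon\mathbb Z)$: functions $u:\epsilon\mathbb Z\to\mathbb R$ with $u(X_{i+N})=u(X_i)$; $U^N_\#(\epsilon\mathbb Z)$: those with $\langle u\rangle_X:=\frac1N\sum_{i=1}^Nu(X_i)=0$. $\langle u,v\rangle_X=\frac1N\sum_{i=1}^Nu(X_i)v(X_i)$, $Du(X_i)=(u(X_{i+1})-u(X_i))/\epsilon$, $\|u\|_{L^2}=\langle u,u\rangle_X^{1/2}$, $|u|_{H^1}=\|Du\|_{L^2}$. $U^p_\#(\epsilon\mathbb Z)$: $p$-periodic functions on $\epsilon\mathbb Z$ with $\sum_{i=1}^p w(X_i)=0$. Two-scale functions $g:\epsilon\mathbb Z\times\mathbb Z\to\mathbb R$ satisfy $g(X_{i+N},Y_j)=g(X_i,Y_j)=g(X_i,Y_{j+p})$; $D_Xg(X_i,Y_j)=(g(X_{i+1},Y_j)-g(X_i,Y_j))/\epsilon$,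 $\langle g\rangle_Y(X_i)=\frac1p\sum_{j=1}^pg(X_i,Y_j)$, $\|g\|_{L^\infty(N,p)}=\max_{1\le i\le N,1\le j\le p}|g|$. $\psi$ is a two-scale function with (A1) $0<c_\psi\le\psi\le C_\psi$ and (A2) $\|D_X\psi\|_{L^\infty(N,p)}\le C'_\psi$. $\psi^0(X_i)=\langle1/\psi(X_i,\cdot)\rangle_Y^{-1}$. $f\in U^N_{\rm per}(\epsilon\mathbb Z)$. Homogenized problem: $u^0\in U^N_\#(\epsilon\mathbb Z)$ with $\langle\psi^0Du^0,Dv\rangle_X=\langle f,v\rangle_X$ for all $v\in U^N_{\rm per}(\epsilon\mathbb Z)$. HQC method: fix indices $1=i_1<i_2<\dots<i_K\le N$, set $i_{K+1}=N+1$, elements $S_k=\{X_i:i_k\le i<i_{k+1}\}$, $H_k=\epsilon(i_{k+1}-i_k)$, $H=\max_kH_k$. $U^H_{\rm per}$ is the set of $v\in U^N_{\rm per}(\epsilon\mathbb Z)$ that are affine in $X_i$ on each $\{X_i: i_k\le i\le i_{k+1}\}$, and $U^H_\#=U^H_{\rm per}\cap U^N_\#(\epsilon\mathbb Z)$. In each $S_k$ choose a sampling domain $S_k^{\rm rep}=\{X_i: i_k^{\rm rep}\le i<i_k^{\rm rep}+p\}\subset S_k$ and a collocation index $i_k^{\rm coll}$ with $X_{i_k^{\rm coll}}\in S_k^{\rm rep}$; let $\psi^\epsilon_{{\rm coll},k}(X_i)=\psi(X_{i_k^{\rm coll}},X_i/\epsilon)$ and $\langle a,b\rangle_{S_k^{\rm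 rep}}=\frac1p\sum_{X_i\in S_k^{\rm rep}}a(X_i)b(X_i)$. For $v^H\in U^H_{\rm per}$ let $\ell_k$ be the affine function on $\epsilon\mathbb Z$ coinciding with $v^H$ on $S_k$; the reconstruction is $\mathcal R_k(v^H)=\ell_k+w$, where $w\in U^p_\#(\epsilon\mathbb Z)$ satisfies $\langle\psi^\epsilon_{{\rm coll},k}D(\ell_k+w),Ds\rangle_{S_k^{\rm rep}}=0$ for all $s\in U^p_\#(\epsilon\mathbb Z)$. The HQC problem: find $u^H\in U^H_\#$ with $\sum_{k=1}^KH_k\langle\psi^\epsilon_{{\rm coll},k}D\mathcal R_k(u^H),D\mathcal R_k(v^H)\rangle_{S_k^{\rm rep}}=\langle f,v^H\rangle_X$ for all $v^H\in U^H_\#$. Modeling error: $e_{\rm mod}=u^H-\tilde u^H$, where $\tilde u^H\in U^H_\#$ solves $\langle\psi^0D\tilde u^H,Dv^H\rangle_X=\langle f,v^H\rangle_X$ for all $v^H\in U^H_\#$. *)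

(* Defs.v *)
From HB Require Import structures.
From mathcomp Require Import all_boot all_order all_algebra.
From mathcomp Require Import boolp classical_sets reals.
Set Implicit Arguments. Unset Strict Implicit. Unset Printing Implicit Defensive.
Import Order.TTheory GRing.Theory Num.Theory.
Local Open Scope ring_scope.

(* Conventions: a function on eps*Z is represented by its values at the
   integer indices, u : int -> R, u i = u(X_i) with X_i = eps * i, eps = 1/N.
   A two-scale function g is  g : int -> int -> R, g i j = g(X_i, Y_j), Y_j = j. *)

Section HQC.
Variable R : realType.

Definition eps (N : nat) : R := (N%:R)^-1.

Definition periodic (n : nat) (u : int -> R) : Prop := forall i : int, u (i + n%:Z) = u i.

Definition avgX (N : nat) (u : int -> R) : R :=
  (N%:R)^-1 * \sum_(1 <= i < N.+1) u (i%:Z).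

Definition ipX (N : nat) (u v : int -> R) : R := avgX N (fun i => u i * v i).

Definition Dd (N : nat) (u : int -> R) : int -> R :=
  fun i => (u (i + 1) - u i) / eps N.

Definition L2norm (N : nat) (u : int -> R) : R := Num.sqrt (ipX N u u).
Definition H1semi (N : nat) (u : int -> R) : R := L2norm N (Dd N u).

Definition UNper (N : nat) (u : int -> R) : Prop := periodic N u.
Definition UNsharp (N : nat) (u : int -> R) : Prop := periodic N u /\ avgX N u = 0.

Definition Upsharp (p : nat) (w : int -> R) : Prop :=
  periodic p w /\ \sum_(1 <= i < p.+1) w (i%:Z) = 0.

Definition two_scale (N p : nat) (g : int -> int -> R) : Prop :=
  forall i j : int, g (i + N%:Z) j = g i j /\ g i (j + p%:Z) = g i j.

Definition DX (N : nat) (g : int -> int -> R) : int -> int -> R :=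
  fun i j => (g (i + 1) j - g i j) / eps N.

Definition Linf (N p : nat) (g : int -> int -> R) : R :=
  \big[Num.max/0]_(1 <= i < N.+1) \big[Num.max/0]_(1 <= j < p.+1) `|g i%:Z j%:Z|.

Definition A1 (cpsi Cpsi : R) (psi : int -> int -> R) : Prop :=
  0 < cpsi /\ forall i j, cpsi <= psi i j /\ psi i j <= Cpsi.
Definition A2 (N p : nat) (Cpsi' : R) (psi : int -> int -> R) : Prop :=
  Linf N p (DX N psi) <= Cpsi'.

Definition avgY (p : nat) (g : int -> int -> R) (i : int) : R :=
  (p%:R)^-1 * \sum_(1 <= j < p.+1) g i j%:Z.

Definition psi0 (p : nat) (psi : int -> int -> R) : int -> R :=
  fun i => (avgY p (fun a b => (psi a b)^-1) i)^-1.

Definition homog_sol (N p : nat) (psi : int -> int -> R) (f u0 : int -> R) : Prop :=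
  UNsharp N u0 /\
  forall v, UNper N v ->
    ipX N (fun i => psi0 p psi i * Dd N u0 i) (Dd N v) = ipX N f v.

Definition mesh (N K : nat) (idx : nat -> nat) : Prop :=
  (0 < K)%N /\ idx 1%N = 1%N /\
  (forall k, (1 <= k < K)%N -> (idx k < idx k.+1)%N) /\
  (idx K <= N)%N /\ idx K.+1 = N.+1.

Definition Hk (N : nat) (idx : nat -> nat) (k : nat) : R :=
  eps N * (idx k.+1 - idx k)%N%:R.
Definition Hmax (N K : nat) (idx : nat -> nat) : R :=
  \big[Num.max/0]_(1 <= k < K.+1) Hk N idx k.

Definition UHper (N K : nat) (idx : nat -> nat) (v : int -> R) : Prop :=
  periodic N v /\
  forall k, (1 <= k <= K)%N -> exists a b : R,
    forall i : int, (idx k)%:Z <= i <= (idx k.+1)%:Z -> v i = a + b * (eps N * i%:~R).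
Definition UHsharp (N K : nat) (idx : nat -> nat) (v : int -> R) : Prop :=
  UHper N K idx v /\ avgX N v = 0.

(* sampling domains S_k^rep = {X_i : rep k <= i < rep k + p} subset S_k,
   collocation index coll k with X_(coll k) in S_k^rep *)
Definition sampling (p K : nat) (idx rep coll : nat -> nat) : Prop :=
  forall k, (1 <= k <= K)%N ->
    (idx k <= rep k)%N /\ (rep k + p <= idx k.+1)%N /\
    (rep k <= coll k < rep k + p)%N.

(* psi^eps_{coll,k}(X_i) = psi(X_{coll k}, X_i / eps) *)
Definition psi_coll (psi : int -> int -> R) (coll : nat -> nat) (k : nat) : int -> R :=
  fun i => psi (coll k)%:Z i.

Definition ipRep (p : nat) (rep : nat -> nat) (k : nat) (a b : int -> R) : R :=
  (p%:R)^-1 * \sum_(rep k <= i < rep k + p) a i%:Z * b i%:Z.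

Definition recon_spec (N p : nat) (psi : int -> int -> R) (idx rep coll : nat -> nat)
    (k : nat) (v r : int -> R) : Prop :=
  exists (a b : R) (w : int -> R),
    let l := fun i : int => a + b * (eps N * i%:~R) in
    (forall i : int, (idx k)%:Z <= i <= (idx k.+1)%:Z -> v i = l i) /\
    Upsharp p w /\
    (forall s, Upsharp p s ->
       ipRep p rep k (fun i => psi_coll psi coll k i * Dd N (fun j => l j + w j) i)
                     (Dd N s) = 0) /\
    r = (fun i => l i + w i).

Definition recon (N p : nat) (psi : int -> int -> R) (idx rep coll : nat -> nat)
    (k : nat) (v : int -> R) : int -> R :=
  xget (fun _ => 0) (recon_spec N p psi idx rep coll k v).

Definition hqc_sol (N p : nat) (psi : int -> int -> R) (f : int -> R) (K : nat)
    (idx rep coll : nat -> nat) (uH : int -> R) : Prop :=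
  UHsharp N K idx uH /\
  forall vH, UHsharp N K idx vH ->
    \sum_(1 <= k < K.+1)
       Hk N idx k * ipRep p rep k
          (fun i => psi_coll psi coll k i * Dd N (recon N p psi idx rep coll k uH) i)
          (Dd N (recon N p psi idx rep coll k vH))
    = ipX N f vH.

Definition galerkin_sol (N p : nat) (psi : int -> int -> R) (f : int -> R) (K : nat)
    (idx : nat -> nat) (tuH : int -> R) : Prop :=
  UHsharp N K idx tuH /\
  forall vH, UHsharp N K idx vH ->
    ipX N (fun i => psi0 p psi i * Dd N tuH i) (Dd N vH) = ipX N f vH.

End HQC.

(* Main.v *)
Require Import Defs.
From HB Require Import structures.
From mathcomp Require Import all_boot all_order all_algebra.
From mathcomp Require Import boolp classical_sets reals.
From mathcomp Require Import zify ring lra.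
Import Order.TTheory GRing.Theory Num.Theory.
Local Open Scope ring_scope.

(** Testing the cell problem with its corrector shows that the HQC form on an
    element is [H_k psi0(X_coll) b_k(u) b_k(v)], [b_k] being the slopes: HQC is
    the Galerkin method for the homogenized problem with [psi0] frozen at the
    collocation points, an [O(H)] perturbation since [psi0] is Lipschitz.
    In one dimension the flux [s = psi0 Du0] satisfies [s(i-1) - s(i) = eps f(i)],
    so it is bounded by [|f|] and oscillates by at most [(H_k eps sum_{S_k} f^2)^{1/2}]
    on [S_k]; the nodal interpolant, whose difference quotient is the mean of [Du0]
    on each element, is therefore [O(H)] close to [u0] in [H^1].  Strang's and
    Cea's lemmas give the [H^1] estimates, and the Aubin-Nitsche argument the
    [L^2] estimate of the Galerkin solution, to which the modeling error is added. *)

(** * Cauchy-Schwarz inequalities for finite sums *)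

Lemma sumr_CauchySchwarz (R : realType) (I : Type) (r : seq I) (x y : I -> R) :
  (\sum_(i <- r) x i * y i) ^+ 2 <=
  (\sum_(i <- r) x i ^+ 2) * (\sum_(i <- r) y i ^+ 2).
Proof.
set P := \sum_(i <- r) _ * _; set A := \sum_(i <- r) _; set B := \sum_(i <- r) y _ ^+ 2.
have quad s t : 0 <= s ^+ 2 * A - 2 * (s * t) * P + t ^+ 2 * B.
  have -> : s ^+ 2 * A - 2 * (s * t) * P + t ^+ 2 * B =
            \sum_(i <- r) (s * x i - t * y i) ^+ 2.
    rewrite /A /P /B !mulr_sumr -sumrN -!big_split /=.
    by apply: eq_bigr => i _; ring.
  by apply: sumr_ge0 => i _; apply: sqr_ge0.
have B0 : 0 <= B by apply: sumr_ge0 => i _; apply: sqr_ge0.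
move: B0; rewrite le_eqVlt => /orP[/eqP B0|B0].
  (* In the degenerate case [B = 0] this choice of [s] and [t] makes the quadratic form equal to
     [- P ^+ 2], so [P] vanishes. *)
  have := quad P ((A + 1) / 2); rewrite -B0 !mulr0 addr0.
  have A0 : 0 <= A by apply: sumr_ge0 => i _; apply: sqr_ge0.
  have := sqr_ge0 P; nra.
rewrite -(ler_pM2l B0); have := quad B P; lra.
Qed.

Lemma sqr_sumr_nat_le (R : realType) (a b : nat) (x : nat -> R) :
  (\sum_(a <= i < b) x i) ^+ 2 <= (b - a)%:R * \sum_(a <= i < b) x i ^+ 2.
Proof.
have := @sumr_CauchySchwarz R _ (index_iota a b) (fun=> 1) x.
under eq_bigr do rewrite mul1r.
by under [in X in X * _]eq_bigr do rewrite expr1n; rewrite sumr_const_nat.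
Qed.

(** * The discrete inner product, its norm and weighted bounds *)

Section Ip.
Context {R : realType}.
Implicit Types (u v w f : int -> R) (N : nat).

Lemma eq_ipX N u v u' v' :
  (forall i : nat, (1 <= i <= N)%N -> u i * v i = u' i * v' i) ->
  ipX N u v = ipX N u' v'.
Proof. by move=> e; rewrite /ipX /avgX; congr (_ * _); apply: eq_big_nat => i /e. Qed.

Lemma ler_ipX N u v u' v' :
  (forall i : nat, (1 <= i <= N)%N -> u i * v i <= u' i * v' i) ->
  ipX N u v <= ipX N u' v'.
Proof.
move=> e; rewrite /ipX /avgX; apply: ler_wpM2l; first by rewrite invr_ge0 ler0n.
by apply: ler_sum_nat => i /e.
Qed.

Lemma ipXC N u v : ipX N u v = ipX N v u.
Proof. by apply: eq_ipX => i _; rewrite mulrC. Qed.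

Lemma ipXDl N u v w : ipX N (u \+ v) w = ipX N u w + ipX N v w.
Proof.
rewrite /ipX /avgX -mulrDr -big_split /=; congr (_ * _).
by apply: eq_bigr => i _; rewrite mulrDl.
Qed.

Lemma ipXBl N u v w : ipX N (u \- v) w = ipX N u w - ipX N v w.
Proof.
rewrite /ipX /avgX -mulrBr -sumrB; congr (_ * _).
by apply: eq_bigr => i _; rewrite mulrBl.
Qed.

Lemma ipXBr N u v w : ipX N w (u \- v) = ipX N w u - ipX N w v.
Proof. by rewrite ipXC ipXBl !(ipXC N w). Qed.

Lemma ipXZl N c u v : ipX N (fun i => c * u i) v = c * ipX N u v.
Proof.
rewrite /ipX /avgX [RHS]mulrCA [in RHS]mulr_sumr; congr (_ * _).
by apply: eq_bigr => i _; rewrite mulrA.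
Qed.

Lemma ipX_ge0 N u : 0 <= ipX N u u.
Proof.
apply: mulr_ge0; first by rewrite invr_ge0 ler0n.
by apply: sumr_ge0 => i _; rewrite -expr2 sqr_ge0.
Qed.

Lemma L2norm_ge0 N u : 0 <= L2norm N u.
Proof. exact: sqrtr_ge0. Qed.

Lemma sqr_L2norm N u : L2norm N u ^+ 2 = ipX N u u.
Proof. by rewrite sqr_sqrtr ?ipX_ge0. Qed.

Lemma ipX_CauchySchwarz N u v : ipX N u v <= L2norm N u * L2norm N v.
Proof.
rewrite (le_trans (ler_norm _)) // -ler_sqr ?nnegrE ?mulr_ge0 ?L2norm_ge0 //.
rewrite real_normK ?num_real // [leRHS]exprMn !sqr_L2norm /ipX /avgX exprMn [leRHS]mulrACA -expr2.
apply: ler_wpM2l; first exact: sqr_ge0.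
by apply: sumr_CauchySchwarz.
Qed.

Lemma L2normD N u v : L2norm N (u \+ v) <= L2norm N u + L2norm N v.
Proof.
rewrite -ler_sqr ?nnegrE ?addr_ge0 ?L2norm_ge0 // sqrrD !sqr_L2norm.
rewrite ipXDl !(ipXC N _ (u \+ v)) !ipXDl (ipXC N v u).
have := ipX_CauchySchwarz N u v; lra.
Qed.

Lemma L2norm_le N u v :
  (forall i : nat, (1 <= i <= N)%N -> `|u i| <= `|v i|) -> L2norm N u <= L2norm N v.
Proof.
move=> e; apply: ler_wsqrtr; apply: ler_ipX => i /e.
by rewrite -!expr2 -(real_normK (num_real (u i))) -(real_normK (num_real (v i))) ler_sqr ?nnegrE.
Qed.

Lemma L2normZ N c u : 0 <= c -> L2norm N (fun i => c * u i) = c * L2norm N u.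
Proof.
move=> c0; apply: (@pexpIrn _ 2) => //; rewrite ?nnegrE ?mulr_ge0 ?L2norm_ge0 //.
rewrite exprMn !sqr_L2norm ipXZl ipXC ipXZl; ring.
Qed.

Lemma L2norm_bound N u M : (0 < N)%N -> 0 <= M ->
  (forall i : nat, (1 <= i <= N)%N -> `|u i| <= M) -> L2norm N u <= M.
Proof.
move=> N0 M0 uM.
apply: (@le_trans _ _ (L2norm N (fun=> M))).
  by apply: L2norm_le => i /uM; rewrite (ger0_norm M0).
rewrite /L2norm /ipX /avgX sumr_const_nat subn1 /= -(mulr_natr (M * M)) mulrC mulfK.
  by rewrite -expr2 sqrtr_sqr ger0_norm.
by rewrite pnatr_eq0 -lt0n.
Qed.

(** Coercivity gives [c * L2norm N v ^+ 2 <= M * L2norm N v], and one factor cancels; if the norm is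
    zero, [0 <= M] suffices. *)
Lemma ipX_coercive N (al v : int -> R) c M : 0 < c ->
  (forall i : nat, (1 <= i <= N)%N -> c <= al i) ->
  ipX N (fun i => al i * v i) v <= M * L2norm N v ->
  0 <= M ->
  L2norm N v <= M / c.
Proof.
move=> c0 cal h M0; rewrite ler_pdivlMr //.
have : c * L2norm N v ^+ 2 <= M * L2norm N v.
  apply: le_trans h; rewrite sqr_L2norm -ipXZl; apply: ler_ipX => i /cal.
  by have := sqr_ge0 (v i); nra.
have := L2norm_ge0 N v; rewrite le_eqVlt => /orP[/eqP <-|]; first lra.
nra.
Qed.

Lemma ipX_coef_le N (al u v : int -> R) M : 0 <= M ->
  (forall i : nat, (1 <= i <= N)%N -> `|al i| <= M) ->
  ipX N (fun i => al i * u i) v <= M * L2norm N u * L2norm N v.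
Proof.
move=> M0 h; apply: le_trans (ipX_CauchySchwarz _ _ _) _.
apply: ler_wpM2r; first exact: L2norm_ge0.
rewrite -L2normZ //; apply: L2norm_le => i /h hi.
by rewrite !normrM (ger0_norm M0) ler_wpM2r.
Qed.

End Ip.

(** * Difference quotients of periodic functions *)

Section Diff.
Context {R : realType}.
Implicit Types (u v w f : int -> R) (N : nat).

Lemma DdE N u i : Dd N u i = N%:R * (u (i + 1) - u i).
Proof. by rewrite /Dd /eps invrK mulrC. Qed.

Lemma DdB N u v : Dd N (u \- v) = Dd N u \- Dd N v.
Proof. by apply/funext => i /=; rewrite !DdE /=; ring. Qed.

Lemma periodic_sum n (F : int -> R) (a : nat) : periodic n F ->
  \sum_(a <= i < a + n) F i = \sum_(1 <= i < n.+1) F i.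
Proof.
move=> Fp; suff E b : \sum_(b <= i < b + n) F i = \sum_(0 <= i < n) F i.
  by rewrite E -(E 1%N) add1n.
elim: b => [|b <-]; first by rewrite add0n.
case: n Fp => [|n] Fp; first by rewrite !addn0 !big_geq.
rewrite addSn big_nat_recr /=; last by lia.
rewrite [in RHS]big_ltn; last by lia.
by rewrite addrC -(Fp b) PoszD.
Qed.

Lemma periodic_Dd n N u : periodic n u -> periodic n (Dd N u).
Proof. by move=> up i; rewrite !DdE addrAC !up. Qed.

Lemma sum_Dd n N u (a : nat) : periodic n u -> \sum_(a <= i < a + n) Dd N u i = 0.
Proof.
move=> up; under eq_bigr do rewrite DdE.
rewrite -mulr_sumr.
rewrite (_ : \sum_(a <= i < a + n) _ = u (a + n)%N - u a).
  by rewrite PoszD up subrr mulr0.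
rewrite (eq_bigr (fun i : nat => u i.+1 - u i)); last first.
  by move=> i _; rewrite [i%:Z + 1]addrC -intS.
by rewrite (telescope_sumr (fun i : nat => u i)) ?leq_addr.
Qed.

Lemma ipX_by_parts N u v : periodic N u -> periodic N v ->
  ipX N u (Dd N v) = ipX N (fun i => N%:R * (u (i - 1) - u i)) v.
Proof.
move=> up vp; apply/eqP; rewrite -subr_eq0 -mulrBr -sumrB; apply/eqP.
(* Discrete product rule: the two integrands differ by the difference quotient of a periodic
   function, which sums to zero over a period. *)
rewrite (eq_bigr (fun i : nat => Dd N (fun i => u (i - 1) * v i) i)); last first.
  by move=> i _; rewrite !DdE addrK; ring.
rewrite -add1n sum_Dd ?mulr0 // => i; rewrite vp; congr (_ * _).
by rewrite addrAC up.
Qed.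

(* The values are read off a primitive of [h] on [1..n] at the residue of
   [i - 1] modulo [n], which makes periodicity automatic. *)
Lemma periodic_primitive N n (h : nat -> R) : (0 < N)%N -> (0 < n)%N ->
  \sum_(1 <= i < n.+1) h i = 0 ->
  exists w, Upsharp n w /\ forall i : nat, (1 <= i <= n)%N -> Dd N w i = h i.
Proof.
move=> N0 n0 h0.
pose W (i : int) : R := \sum_(1 <= j < (absz ((i - 1) %% n)%Z).+1) h j / N%:R.
have nz : n%:R != 0 :> R by rewrite pnatr_eq0 -lt0n.
have Nz : N%:R != 0 :> R by rewrite pnatr_eq0 -lt0n.
have Wp : periodic n W by move=> i; rewrite /W addrAC modzDr.
have Wi (i : nat) : (1 <= i <= n)%N -> W i = \sum_(1 <= j < i) h j / N%:R.
  case: i => // i /= ile; rewrite /W intS addrC addKr.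
  by rewrite modz_nat absz_nat modn_small.
have WS (i : nat) : (1 <= i <= n)%N -> W i.+1 = \sum_(1 <= j < i.+1) h j / N%:R.
  move=> /andP[i1 ile]; move: (ile); rewrite leq_eqVlt => /orP[/eqP ->|iltn].
    (* At [i = n] the residue wraps around and [W] restarts from an empty sum; the hypothesis [h0]
       makes the two values agree. *)
    have -> : n.+1%:Z = 1 + n%:Z by lia.
    by rewrite Wp Wi // big_geq // -mulr_suml h0 mul0r.
  by rewrite Wi.
pose M := (\sum_(1 <= i < n.+1) W i) / n%:R.
exists (fun i => W i - M); split; first split.
- by move=> i; rewrite Wp.
- rewrite sumrB sumr_const_nat subn1 /= -[_ *+ _]mulr_natr /M divfK // subrr //.
- move=> i hi; rewrite DdE.
  have -> : i%:Z + 1 = i.+1 by lia.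
  rewrite WS // Wi // big_nat_recr /=; last by case/andP: hi.
  by field.
Qed.

End Diff.

(** * The mesh and the piecewise affine functions *)

Section Mesh.
Context {R : realType} {N K : nat} {idx : nat -> nat}.
Hypothesis msh : mesh N K idx.
Implicit Types (u v w : int -> R).

Lemma mesh_ltS k : (1 <= k <= K)%N -> (idx k < idx k.+1)%N.
Proof.
case: msh => K0 [_ [inc [leN last]]] /andP[k1]; rewrite leq_eqVlt.
by case/orP => [/eqP ->|kK]; [rewrite last ltnS | apply: inc; rewrite k1].
Qed.

Lemma mesh_le k l : (1 <= k)%N -> (k <= l)%N -> (l <= K.+1)%N -> (idx k <= idx l)%N.
Proof.
move=> k1 kl; rewrite -(subnKC kl); elim: (l - k)%N => [|d IH]; first by rewrite addn0.
rewrite addnS => h; apply: leq_trans (IH (ltnW h)) (ltnW (mesh_ltS _ _)).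
by lia.
Qed.

Lemma mesh_range k (i : nat) :
  (1 <= k <= K)%N -> (idx k <= i < idx k.+1)%N -> (1 <= i <= N)%N.
Proof.
move=> hk hi; case: msh => K0 [i1 [_ [_ last]]].
have := mesh_le 1%N k isT; have := mesh_le k.+1 K.+1 isT; lia.
Qed.

Lemma mesh_bounds k : (1 <= k <= K)%N -> (1 <= idx k)%N /\ (idx k.+1 <= N.+1)%N.
Proof.
move=> hk; have := mesh_ltS k hk.
by have := mesh_range k (idx k) hk; have := mesh_range k (idx k.+1).-1 hk; lia.
Qed.

Lemma mesh_uniq k l (i : nat) : (1 <= k <= K)%N -> (1 <= l <= K)%N ->
  (idx k <= i < idx k.+1)%N -> (idx l <= i < idx l.+1)%N -> k = l.
Proof.
move=> hk hl ik il; apply/eqP; rewrite eqn_leq; apply/andP; split; rewrite leqNgt;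
  apply/negP => h.
- have := mesh_le l.+1 k isT h; lia.
- have := mesh_le k.+1 l isT h; lia.
Qed.

Lemma mesh_cover (i : nat) : (1 <= i <= N)%N ->
  exists k, (1 <= k <= K)%N && (idx k <= i < idx k.+1)%N.
Proof.
move=> hi; case: msh => K0 [i1 [_ [_ last]]].
pose P k := (1 <= k <= K)%N && (idx k <= i)%N.
have P1 : exists k, P k by exists 1%N; rewrite /P i1; lia.
have PK k : P k -> (k <= K)%N by rewrite /P; lia.
case: (ex_maxnP P1 PK) => k /andP[kK ik] kmax; exists k; rewrite kK ik /=.
rewrite ltnNge; apply/negP => h.
have [E|kK'] := eqVneq k K; first by move: h; rewrite E last; lia.
by have := kmax k.+1; rewrite /P h; lia.
Qed.

(** Turns data given per element, such as slopes or frozen coefficients, into functions of the grid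
    index. *)
Lemma mesh_locate :
  exists loc : nat -> nat, forall k (i : nat),
    (1 <= k <= K)%N -> (idx k <= i < idx k.+1)%N -> loc i = k.
Proof.
have /choice[loc locP] : forall i : nat, exists k, (1 <= i <= N)%N ->
    (1 <= k <= K)%N && (idx k <= i < idx k.+1)%N.
  move=> i; case: (boolP (1 <= i <= N)%N) => [/mesh_cover[k hk]|_]; first by exists k.
  by exists 0%N.
exists loc => k i hk hi; have /andP[hl il] := locP i (mesh_range _ _ hk hi).
exact: mesh_uniq hl hk il hi.
Qed.

Lemma mesh_sum (F : nat -> R) :
  \sum_(1 <= i < N.+1) F i = \sum_(1 <= k < K.+1) \sum_(idx k <= i < idx k.+1) F i.
Proof.
case: msh => K0 [i1 [_ [_ last]]].
suff E k : (k <= K)%N ->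
    \sum_(1 <= i < idx k.+1) F i = \sum_(1 <= l < k.+1) \sum_(idx l <= i < idx l.+1) F i.
  by rewrite -E // last.
elim: k => [_|k IH kK]; first by rewrite i1 !big_geq.
rewrite big_nat_recr //= -IH; last exact: ltnW.
rewrite -big_cat_nat //=; first by have := mesh_le 1%N k.+1 isT; lia.
by apply/ltnW/mesh_ltS.
Qed.

Lemma Hk_ge0 k : 0 <= Hk R N idx k.
Proof. by rewrite mulr_ge0 ?invr_ge0 ?ler0n. Qed.

Lemma Hk_le_Hmax k : (1 <= k <= K)%N -> Hk R N idx k <= Hmax R N K idx.
Proof.
move=> hk; rewrite /Hmax; apply: (@le_bigmax_seq _ _ _ _ _ k xpredT (Hk R N idx)) => //.
by rewrite mem_index_iota.
Qed.

Lemma Hmax_ge0 : 0 <= Hmax R N K idx.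
Proof. exact: bigmax_ge_id. Qed.

Lemma mesh_gt0 : (0 < N)%N.
Proof. by case: msh => K0 [i1 [_ [iK _]]]; have := mesh_le 1%N K isT K0; lia. Qed.

Lemma sum_Hk : \sum_(1 <= k < K.+1) Hk R N idx k = 1.
Proof.
rewrite -mulr_sumr.
have := mesh_sum (fun=> 1); rewrite sumr_const_nat subn1 /=.
under [in RHS]eq_bigr do rewrite sumr_const_nat.
by move=> <-; rewrite mulVf // pnatr_eq0 -lt0n mesh_gt0.
Qed.

Lemma UHper_Dd v k (i : nat) : UHper N K idx v -> (1 <= k <= K)%N ->
  (idx k <= i < idx k.+1)%N -> Dd N v i = Dd N v (idx k).
Proof.
move=> [_ vaff] hk hi; have [a [b hv]] := vaff _ hk.
rewrite !DdE !hv; try lia.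
by rewrite !rmorphD /=; ring.
Qed.

Lemma UHsharpB u v : UHsharp N K idx u -> UHsharp N K idx v -> UHsharp N K idx (u \- v).
Proof.
move=> [[up ua] u0] [[vp va] v0]; split; first split.
- by move=> i /=; rewrite up vp.
- move=> k hk; have [a [b h]] := ua _ hk; have [a' [b' h']] := va _ hk.
  by exists (a - a'), (b - b') => i hi; rewrite /= h // h' //; ring.
- by rewrite /avgX sumrB mulrBr; move: u0 v0; rewrite /avgX => -> ->; rewrite subrr.
Qed.

(** The hypothesis says that the piecewise constant function with values [b k] sums to zero over a
    period, so it has a periodic zero-mean primitive, which is affine on each element. *)
Lemma UHsharp_of_slopes (b : nat -> R) :
  \sum_(1 <= k < K.+1) (idx k.+1 - idx k)%N%:R * b k = 0 ->
  exists v, UHsharp N K idx v /\ forall k (i : nat),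
    (1 <= k <= K)%N -> (idx k <= i < idx k.+1)%N -> Dd N v i = b k.
Proof.
move=> b0; have [loc locP] := mesh_locate.
have N0 := mesh_gt0.
have Nz : N%:R != 0 :> R by rewrite pnatr_eq0 -lt0n.
have s0 : \sum_(1 <= i < N.+1) b (loc i) = 0.
  rewrite mesh_sum -[RHS]b0; apply: eq_big_nat => k hk.
  rewrite (eq_big_nat _ _ (F2 := fun=> b k)) => [|i hi]; last by rewrite (locP k).
  by rewrite sumr_const_nat mulr_natl.
have [v [[vp v0] vD]] := periodic_primitive _ _ _ N0 N0 s0.
have vDk k (i : nat) : (1 <= k <= K)%N -> (idx k <= i < idx k.+1)%N -> Dd N v i = b k.
  by move=> hk hi; rewrite vD ?(locP k) ?(mesh_range k).
exists v; split => //; split; last by rewrite /avgX v0 mulr0.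
split=> // k hk; exists (v (idx k) - b k * (idx k)%:R / N%:R), (b k) => -[i|//] hi.
(* Induction on the distance to the left node reaches the right endpoint too, since each step only
   uses the slope at the preceding index. *)
have [d Ed] : exists d, i = (idx k + d)%N by exists (i - idx k)%N; lia.
rewrite {i}Ed in hi *.
elim: d hi => [|d IH] hi.
  by rewrite addn0 /eps -pmulrn; field.
have := vDk k (idx k + d)%N hk; rewrite DdE IH; last by lia.
have -> : (idx k + d)%N%:Z + 1 = (idx k + d.+1)%N%:Z by lia.
set y := (X in _ * (_ - X)) => /(_ ltac:(lia)) vS.
have -> : v (idx k + d.+1)%N = y + b k / N%:R by rewrite -vS; field.
by rewrite /y /eps -!pmulrn addnS -[in RHS]natr1; field.
Qed.

End Mesh.

(** * The homogenized coefficient, and the homogenized problem solved by integration *)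

Section Coefficient.
Context {R : realType} {p N : nat} {cpsi Cpsi Cpsi' : R} {psi : int -> int -> R}.
Hypotheses (p0 : (0 < p)%N) (N0 : (0 < N)%N).
Hypotheses (ts : two_scale N p psi) (a1 : A1 cpsi Cpsi psi) (a2 : A2 N p Cpsi' psi).
Implicit Types (u v w f : int -> R).

(** The reciprocal of [psi0]: being a plain average of [1 / psi], it inherits bounds and Lipschitz
    estimates directly, and these then pass to [psi0]. *)
Local Notation m := (avgY p (fun a b => (psi a b)^-1)).

Lemma psi_gt0 i j : 0 < psi i j.
Proof. by case: a1 => c0 /(_ i j)[/(lt_le_trans c0)]. Qed.

Lemma avgY_bounds (g : int -> int -> R) i a b :
  (forall j : nat, (1 <= j <= p)%N -> a <= g i j <= b) -> a <= avgY p g i <= b.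
Proof.
move=> h.
have pz : 0 < p%:R :> R by rewrite ltr0n.
have E (c : R) : c = p%:R^-1 * \sum_(1 <= j < p.+1) c.
  by rewrite sumr_const_nat subn1 /= -(mulr_natr c) mulrC mulfK // gt_eqF.
apply/andP; split; [rewrite [leLHS]E | rewrite [leRHS]E];
  by apply: ler_wpM2l; rewrite ?invr_ge0 ?ler0n //; apply: ler_sum_nat => j /h /andP[].
Qed.

Lemma cpsi_gt0 : 0 < cpsi. Proof. by case: a1. Qed.

Lemma Cpsi_gt0 : 0 < Cpsi.
Proof. by case: a1 => _ /(_ 0 0)[_]; apply: lt_le_trans (psi_gt0 _ _). Qed.

Lemma harm_bounds i : Cpsi^-1 <= m i <= cpsi^-1.
Proof.
apply: avgY_bounds => j _; case: a1 => c0 /(_ i j)[h1 h2].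
by rewrite !lef_pV2 ?posrE ?h1 ?h2 ?psi_gt0 ?Cpsi_gt0.
Qed.

Lemma harm_gt0 i : 0 < m i.
Proof. by case/andP: (harm_bounds i) => + _; apply: lt_le_trans; rewrite invr_gt0 Cpsi_gt0. Qed.

Lemma psi0_bounds i : cpsi <= psi0 p psi i <= Cpsi.
Proof.
have /andP[h1 h2] := harm_bounds i.
rewrite /psi0 -{1}[cpsi]invrK -[Cpsi]invrK.
by rewrite !lef_pV2 ?posrE ?invr_gt0 ?cpsi_gt0 ?Cpsi_gt0 ?harm_gt0 // h1 h2.
Qed.

Lemma psi0_periodic : periodic N (psi0 p psi).
Proof.
move=> i; rewrite /psi0 /avgY; congr (_ * _)^-1.
by apply: eq_bigr => j _; rewrite (ts i j).1.
Qed.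

Lemma Cpsi'_ge0 : 0 <= Cpsi'.
Proof. by apply: le_trans a2; apply: bigmax_ge_id. Qed.

Lemma DX_le (i j : nat) : (1 <= i <= N)%N -> (1 <= j <= p)%N -> `|DX N psi i j| <= Cpsi'.
Proof.
move=> hi hj; apply: le_trans a2.
pose G (k : nat) := \big[Num.max/0]_(1 <= l < p.+1) `|DX N psi k l|.
apply: (@le_trans _ _ (G i)); last first.
  by apply: (@le_bigmax_seq _ _ _ _ _ i xpredT G); rewrite ?mem_index_iota.
by apply: (@le_bigmax_seq _ _ _ _ _ j xpredT (fun l : nat => `|DX N psi i l|));
  rewrite ?mem_index_iota.
Qed.

Let L := Cpsi' / cpsi ^+ 2.

(** Each term is [1/x - 1/y = - (x - y) / (x * y)] with [x * y >= cpsi ^+ 2], and (A2) bounds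
    [x - y]. *)
Lemma harm_lip1 (i : nat) : (1 <= i <= N)%N -> `|m i.+1 - m i| <= eps R N * L.
Proof.
move=> hi.
have e0 : 0 < eps R N by rewrite invr_gt0 ltr0n.
rewrite ler_norml.
have -> : m i.+1 - m i = avgY p (fun a b => (psi (a + 1) b)^-1 - (psi a b)^-1) i.
  by rewrite /avgY -mulrBr -sumrB intS addrC.
apply: avgY_bounds => j hj; rewrite -ler_norml.
have := DX_le _ _ hi hj; rewrite /DX normrM normfV (gtr0_norm e0) ler_pdivrMr //.
have x0 := psi_gt0 (i%:Z + 1) j; have y0 := psi_gt0 i j.
case: a1 => c0 hp; case: (hp (i%:Z + 1) j) (hp i j) => hx _ [hy _].
set x := psi _ _ in x0 hx *; set y := psi _ _ in y0 hy * => xy.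
have -> : x^-1 - y^-1 = - (x - y) / (x * y) by field; rewrite !gt_eqF.
rewrite normrM normrN normfV (gtr0_norm (mulr_gt0 x0 y0)).
rewrite ler_pdivrMr ?mulr_gt0 //; apply: le_trans xy _.
have -> : eps R N * L * (x * y) = Cpsi' * eps R N * ((x * y) / cpsi ^+ 2).
  by rewrite /L; ring.
rewrite ler_peMr ?mulr_ge0 ?Cpsi'_ge0 ?(ltW e0) // ler_pdivlMr ?exprn_gt0 // mul1r expr2.
by apply: ler_pM; rewrite ?(ltW c0).
Qed.

Lemma harm_lip (a b i j : nat) : (1 <= a)%N -> (b <= N.+1)%N ->
  (a <= i < b)%N -> (a <= j < b)%N -> `|m i - m j| <= eps R N * (b - a)%N%:R * L.
Proof.
move=> a1' bN.
have e0 : 0 <= eps R N by rewrite invr_ge0 ler0n.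
have L0 : 0 <= L by rewrite divr_ge0 ?Cpsi'_ge0 ?sqr_ge0.
wlog ij : i j / (j <= i)%N => [h hi hj|hi hj].
  case/orP: (leq_total j i) => [/h|/h]; first exact.
  by rewrite distrC; exact.
apply: (@le_trans _ _ (eps R N * (i - j)%N%:R * L)); last first.
  by rewrite ler_wpM2r // ler_wpM2l // ler_nat; lia.
rewrite -(telescope_sumr (fun k : nat => m k)) //; apply: le_trans (ler_norm_sum _ _ _) _.
apply: (@le_trans _ _ (\sum_(j <= k < i) eps R N * L)).
  by apply: ler_sum_nat => k hk; apply: harm_lip1; lia.
by rewrite sumr_const_nat -(mulr_natr (eps R N * L)) mulrAC.
Qed.

Lemma psi0_lip (a b i j : nat) : (1 <= a)%N -> (b <= N.+1)%N ->
  (a <= i < b)%N -> (a <= j < b)%N ->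
  `|psi0 p psi i - psi0 p psi j| <= Cpsi ^+ 2 * L * (eps R N * (b - a)%N%:R).
Proof.
move=> a1' bN hi hj.
have -> : psi0 p psi i - psi0 p psi j = psi0 p psi i * psi0 p psi j * (m j - m i).
  by rewrite /psi0; field; rewrite !gt_eqF ?harm_gt0.
rewrite -[leRHS]mulrA (mulrC L) normrM; apply: ler_pM => //; last exact: harm_lip hj hi.
have := psi0_bounds i; have := psi0_bounds j; have := cpsi_gt0.
move: (psi0 _ _ i) (psi0 _ _ j) => x y c0 /andP[y1 y2] /andP[x1 x2].
by rewrite normrM expr2 !ger0_norm ?ler_pM //; lra.
Qed.

(** The residual of the strong equation is itself periodic, hence an admissible test function;
    tested against itself it has zero norm. *)
Lemma homog_flux u f : periodic N f -> homog_sol N p psi f u ->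
  forall i : nat, (1 <= i <= N)%N ->
  N%:R * (psi0 p psi (i%:Z - 1) * Dd N u (i%:Z - 1) - psi0 p psi i * Dd N u i) = f i.
Proof.
move=> fp [[up _] hu] i hi.
pose s i := psi0 p psi i * Dd N u i.
have sp : periodic N s by move=> k; rewrite /s psi0_periodic periodic_Dd.
pose r := (fun i => N%:R * (s (i - 1) - s i)) \- f.
have rp : periodic N r by move=> k; rewrite /r /= fp sp addrAC sp.
have : ipX N r r = 0 by rewrite ipXBl -(ipX_by_parts _ _ _ sp rp) hu // subrr.
move/eqP; rewrite /ipX /avgX mulf_eq0 invr_eq0 pnatr_eq0 eqn0Ngt N0 /=.
rewrite big_nat psumr_eq0 => [|k _]; last by rewrite -expr2 sqr_ge0.
move=> /allP /(_ i); rewrite mem_index_iota ltnS hi /= mulf_eq0 orbb subr_eq0.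
by move=> /(_ isT) /eqP.
Qed.

(** Integrating [f] gives the flux up to a constant, and integrating [m] times the flux gives [u].
    It will supply the solution of the dual problem. *)
Lemma homog_exists f : periodic N f -> avgX N f = 0 -> exists u, homog_sol N p psi f u.
Proof.
move=> fp f0.
have Nz : N%:R != 0 :> R by rewrite pnatr_eq0 -lt0n.
have f0' : \sum_(1 <= i < N.+1) f i%:Z = 0.
  by move/eqP: f0; rewrite /avgX mulf_eq0 invr_eq0 (negbTE Nz) => /eqP.
have [W [[Wp _] WD]] := periodic_primitive _ _ _ N0 N0 f0'.
pose M := \sum_(1 <= i < N.+1) m i.
have M0 : 0 < M.
  by rewrite /M big_nat_recl //; apply: ltr_wpDr (harm_gt0 _);
    apply: sumr_ge0 => i _; apply/ltW/harm_gt0.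
(* The constant of integration is fixed by the requirement that [m * s], the future [Dd N u], sum to
   zero. *)
pose t := (\sum_(1 <= i < N.+1) m i * W (i%:Z + 1)) / M.
(* The shift by one turns the backward difference of [s] into the forward difference of [W]. *)
pose s (i : int) := t - W (i + 1).
have s0 : \sum_(1 <= i < N.+1) m i * s i = 0.
  under eq_bigr do rewrite mulrBr.
  by rewrite sumrB -mulr_suml -/M /t mulrC divfK ?gt_eqF // subrr.
have [u [[up u0] uD]] := periodic_primitive _ _ _ N0 N0 s0.
exists u; split; first by split=> //; rewrite /avgX u0 mulr0.
move=> v vp.
have sp : periodic N s by move=> i; rewrite /s addrAC Wp.
rewrite (@eq_ipX _ _ _ _ s (Dd N v)) => [|i hi]; last first.
  by rewrite uD // /psi0 mulKf // gt_eqF // harm_gt0.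
rewrite ipX_by_parts //; apply: eq_ipX => i hi; congr (_ * _).
by rewrite -WD // DdE /s subrK; ring.
Qed.
End Coefficient.

(** * Regularity of the homogenized solution and the interpolation error *)

Lemma sum_sqr_mean_dev (R : realType) (a b : nat) (g : nat -> R) (B : R) :
  (a < b)%N ->
  (forall i j : nat, (a <= i < b)%N -> (a <= j < b)%N -> (g i - g j) ^+ 2 <= B) ->
  \sum_(a <= i < b) (g i - (\sum_(a <= j < b) g j) / (b - a)%N%:R) ^+ 2 <=
  (b - a)%N%:R * B.
Proof.
move=> ab h; set n := (b - a)%N%:R.
have n0 : 0 < n by rewrite ltr0n subn_gt0.
have sumc (c : R) : \sum_(a <= j < b) c = n * c by rewrite sumr_const_nat mulr_natl.
rewrite -sumc; apply: ler_sum_nat => i hi.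
(* The deviation from the mean is the mean of the pairwise differences, to which Cauchy-Schwarz
   applies. *)
have -> : g i - (\sum_(a <= j < b) g j) / n = (\sum_(a <= j < b) (g i - g j)) / n.
  by rewrite sumrB sumc mulrBl mulrAC divff ?gt_eqF // mul1r.
rewrite expr_div_n ler_pdivrMr ?exprn_gt0 //.
apply: le_trans (sqr_sumr_nat_le _ _ _ _) _.
rewrite -/n expr2 mulrCA ler_pM2l // mulrC -sumc.
by apply: ler_sum_nat => j hj; apply: h.
Qed.

Section Regularity.
Context {R : realType} {p N : nat} {cpsi Cpsi Cpsi' : R} {psi : int -> int -> R}.
Hypotheses (p0 : (0 < p)%N) (N0 : (0 < N)%N).
Hypotheses (ts : two_scale N p psi) (a1 : A1 cpsi Cpsi psi) (a2 : A2 N p Cpsi' psi).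
Context {f u : int -> R}.
Hypotheses (fp : periodic N f) (hu : homog_sol N p psi f u).

Let L := Cpsi' / cpsi ^+ 2.
Local Notation m := (avgY p (fun a b => (psi a b)^-1)).
Local Notation s := (fun i : int => psi0 p psi i * Dd N u i).

(** Telescoping the strong equation writes the difference as [eps] times a sum of at most [b - a]
    values of [f]; Cauchy-Schwarz and enlarging the range give the bound. *)
Lemma flux_osc (a b i j : nat) : (1 <= a)%N -> (b <= N.+1)%N ->
  (a <= i < b)%N -> (a <= j < b)%N ->
  (s i - s j) ^+ 2 <= eps R N ^+ 2 * (b - a)%N%:R * \sum_(a <= l < b) f l ^+ 2.
Proof.
move=> a1' bN.
wlog ij : i j / (i <= j)%N => [h hi hj|hi hj].
  case/orP: (leq_total i j) => [/h|/h]; first exact.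
  by rewrite -sqrrN opprB; exact.
have -> : s i - s j = eps R N * \sum_(i.+1 <= l < j.+1) f l.
  rewrite big_add1 /= -opprB -(telescope_sumr (fun l : nat => s l)) // -sumrN mulr_sumr.
  apply: eq_big_nat => l hl; rewrite -(homog_flux N0 ts u f fp hu l.+1); last by lia.
  by rewrite intS [1 + _]addrC addrK opprB mulKf // pnatr_eq0 -lt0n.
rewrite exprMn -mulrA ler_wpM2l ?sqr_ge0 //.
apply: le_trans (sqr_sumr_nat_le _ _ _ _) _.
apply: ler_pM; rewrite ?ler0n //; first by apply: sumr_ge0 => l _; apply: sqr_ge0.
  by rewrite ler_nat; lia.
rewrite (@big_cat_nat _ _ _ i.+1 a b) /=; try lia.
rewrite (@big_cat_nat _ _ _ j.+1 i.+1 b) /=; try lia.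
rewrite addrCA lerDl; apply: addr_ge0; apply: sumr_ge0 => l _; exact: sqr_ge0.
Qed.

(** Since [m * s = Dd N u] sums to zero, [s i] is the [m]-weighted mean of the differences
    [s i - s j], and the oscillation over a full period is at most the norm of [f]. *)
Lemma flux_bound (i : nat) : (1 <= i <= N)%N -> `|s i| <= L2norm N f.
Proof.
move=> hi.
have osc (j : nat) : (1 <= j <= N)%N -> `|s i - s j| <= L2norm N f.
  move=> hj; rewrite -ler_sqr ?nnegrE ?L2norm_ge0 // sqr_L2norm real_normK ?num_real //.
  apply: le_trans (flux_osc 1 N.+1 _ _ _ _ _ _) _ => //.
  rewrite subn1 /= /ipX /avgX /eps expr2 mulfVK ?pnatr_eq0 -?lt0n //.
have sm : \sum_(1 <= j < N.+1) m j * s j = 0.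
  rewrite -[RHS](sum_Dd N N u 1 hu.1.1) add1n; apply: eq_bigr => j _.
  by rewrite /psi0 mulVKf // gt_eqF // (harm_gt0 _ a1).
pose M := \sum_(1 <= j < N.+1) m j.
have M0 : 0 < M.
  by rewrite /M big_nat_recl //; apply: ltr_wpDr (harm_gt0 _ a1 _) => //;
    apply: sumr_ge0 => k _; apply/ltW/(harm_gt0 _ a1).
rewrite -(ler_pM2l M0) -{1}(gtr0_norm M0) -normrM.
have -> : M * s i = \sum_(1 <= j < N.+1) m j * (s i - s j).
  under eq_bigr do rewrite mulrBr.
  by rewrite sumrB sm subr0 /M mulr_suml.
apply: le_trans (ler_norm_sum _ _ _) _; rewrite /M mulr_suml; apply: ler_sum_nat => j hj.
by rewrite normrM (gtr0_norm (harm_gt0 _ a1 _)) // ler_wpM2l ?osc // ltW // (harm_gt0 _ a1).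
Qed.

Lemma Dd_harm_flux i : Dd N u i = m i * s i.
Proof. by rewrite /psi0 mulVKf // gt_eqF // (harm_gt0 _ a1). Qed.

Lemma homog_energy : L2norm N (Dd N u) <= L2norm N f / cpsi.
Proof.
have c0 := cpsi_gt0 a1.
apply: L2norm_bound => //; first by rewrite divr_ge0 ?L2norm_ge0 ?ltW.
move=> i hi; rewrite Dd_harm_flux normrM mulrC; apply: ler_pM => //; first exact: flux_bound.
by rewrite gtr0_norm ?(harm_gt0 _ a1) //; case/andP: (harm_bounds p0 a1 i).
Qed.

Context {K : nat} {idx : nat -> nat}.
Hypothesis msh : mesh N K idx.

(** [Dd N u] is the product [m * s]: its oscillation splits into that of the flux times [m], and
    that of [m] times the flux. The factors 2 come from squaring a sum of two terms. *)
Lemma Dd_osc k (i j : nat) : (1 <= k <= K)%N ->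
  (idx k <= i < idx k.+1)%N -> (idx k <= j < idx k.+1)%N ->
  (Dd N u i - Dd N u j) ^+ 2 <=
  2 / cpsi ^+ 2 * (eps R N ^+ 2 * (idx k.+1 - idx k)%N%:R *
                   \sum_(idx k <= l < idx k.+1) f l ^+ 2) +
  2 * L ^+ 2 * Hk R N idx k ^+ 2 * L2norm N f ^+ 2.
Proof.
move=> hk hi hj.
have c0 := cpsi_gt0 a1.
have [b1 bN] := mesh_bounds msh k hk.
have := flux_osc _ _ _ _ b1 bN hi hj.
have := harm_lip p0 N0 a1 a2 _ _ _ _ b1 bN hi hj.
have := flux_bound _ (mesh_range msh _ _ hk hj).
have := harm_bounds p0 a1 i; have := harm_gt0 p0 a1 i.
set F := (eps R N ^+ 2 * _ * _).
suff: forall mi mj si sj : R, 0 < mi -> Cpsi^-1 <= mi <= cpsi^-1 ->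
    `|sj| <= L2norm N f -> `|mi - mj| <= Hk R N idx k * L -> (si - sj) ^+ 2 <= F ->
    (mi * si - mj * sj) ^+ 2 <=
      2 / cpsi ^+ 2 * F + 2 * L ^+ 2 * Hk R N idx k ^+ 2 * L2norm N f ^+ 2.
  by move=> + m0 mb sb mL sF => /(_ _ _ _ _ m0 mb sb mL sF); rewrite -!Dd_harm_flux.
move=> mi mj si sj mi0 /andP[_ h1] h2 h3 h4.
have -> : mi * si - mj * sj = mi * (si - sj) + sj * (mi - mj) by ring.
apply: (@le_trans _ _ (2 * (mi ^+ 2 * (si - sj) ^+ 2) + 2 * (sj ^+ 2 * (mi - mj) ^+ 2))).
  by have := sqr_ge0 (mi * (si - sj) - sj * (mi - mj)); nra.
rewrite -(mulrA 2 _ F) -[leRHS]/(_ + _).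
have -> : 2 * L ^+ 2 * Hk R N idx k ^+ 2 * L2norm N f ^+ 2 =
          2 * (L2norm N f ^+ 2 * (Hk R N idx k * L) ^+ 2) by ring.
apply: lerD; rewrite ler_pM2l //; apply: ler_pM; rewrite ?sqr_ge0 //.
- by rewrite -exprVn ler_sqr ?nnegrE ?invr_ge0 // ltW.
- by rewrite -(real_normK (num_real sj)) ler_sqr ?nnegrE ?L2norm_ge0.
- rewrite -(real_normK (num_real (_ - _))) ler_sqr ?nnegrE //.
  exact: le_trans (normr_ge0 _) h3.
Qed.

Lemma interpolation_error :
  exists v, [/\ UHsharp N K idx v,
    forall k, (1 <= k <= K)%N -> \sum_(idx k <= i < idx k.+1) Dd N (u \- v) i = 0 &
    L2norm N (Dd N (u \- v)) <= (2 / cpsi + 2 * L) * Hmax R N K idx * L2norm N f].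
Proof.
have c0 := cpsi_gt0 a1.
have up := hu.1.1.
pose n k : R := (idx k.+1 - idx k)%N%:R.
have n0 k : (1 <= k <= K)%N -> 0 < n k by move=> hk; rewrite ltr0n subn_gt0 (mesh_ltS msh).
(* Slopes of the nodal interpolant: the element means of [Dd N u]. The resulting [v] is this
   interpolant shifted to zero mean. *)
pose b k := (\sum_(idx k <= i < idx k.+1) Dd N u i) / n k.
have b0 : \sum_(1 <= k < K.+1) n k * b k = 0.
  rewrite -[RHS](sum_Dd N N u 1 up) add1n (mesh_sum msh); apply: eq_big_nat => k hk.
  by rewrite mulrC divfK // gt_eqF // n0.
have [v [vH vD]] := UHsharp_of_slopes msh b b0.
exists v; split=> // [k hk|].
  rewrite DdB sumrB /= [X in _ - X](eq_big_nat _ _ (F2 := fun=> b k)) => [|i hi].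
    by rewrite sumr_const_nat -mulr_natr divfK ?subrr // gt_eqF // n0.
  exact: vD.
set H := Hmax R N K idx.
have H0 : 0 <= H by exact: Hmax_ge0.
have L0 : 0 <= L by rewrite divr_ge0 ?(Cpsi'_ge0 a2) ?sqr_ge0.
have e0 : 0 < eps R N by rewrite invr_gt0 ltr0n.
set nf := L2norm N f; have nf0 : 0 <= nf := L2norm_ge0 N f.
have ci : 0 <= cpsi^-1 by rewrite invr_ge0 ltW.
have C0 : 0 <= 2 / cpsi + 2 * L by lra.
rewrite -ler_sqr ?nnegrE ?L2norm_ge0 ?(mulr_ge0 (mulr_ge0 C0 H0)) // sqr_L2norm.
apply: (@le_trans _ _ (H ^+ 2 * (2 / cpsi ^+ 2 + 2 * L ^+ 2) * nf ^+ 2)); last first.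
  rewrite -subr_ge0.
  have -> : ((2 / cpsi + 2 * L) * H * nf) ^+ 2 - H ^+ 2 * (2 / cpsi ^+ 2 + 2 * L ^+ 2) * nf ^+ 2
   = (H * nf) ^+ 2 * (2 / cpsi ^+ 2 + 8 * (L / cpsi) + 2 * L ^+ 2).
    by field; rewrite gt_eqF.
  apply: mulr_ge0; first exact: sqr_ge0.
  have c2 : 0 <= (cpsi ^+ 2)^-1 by rewrite invr_ge0 sqr_ge0.
  by have := mulr_ge0 L0 ci; have := sqr_ge0 L; lra.
rewrite /ipX /avgX (mesh_sum msh).
pose F k : R := \sum_(idx k <= l < idx k.+1) f l ^+ 2.
(* The global bound is distributed over the elements, using that the lengths [eps R N * n k] add up
   to 1. *)
have -> : H ^+ 2 * (2 / cpsi ^+ 2 + 2 * L ^+ 2) * nf ^+ 2 =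
  eps R N * \sum_(1 <= k < K.+1) H ^+ 2 * (2 / cpsi ^+ 2 * F k + 2 * L ^+ 2 * nf ^+ 2 * n k).
  rewrite -mulr_sumr big_split /= -!mulr_sumr.
  have hn : eps R N * \sum_(1 <= k < K.+1) n k = 1 by rewrite mulr_sumr (sum_Hk msh).
  have hF : nf ^+ 2 = eps R N * \sum_(1 <= k < K.+1) F k.
    by rewrite /nf sqr_L2norm /ipX /avgX (mesh_sum msh).
  move: (\sum_(_ <= _ < _) F _) (\sum_(_ <= _ < _) n _) hn hF => SF Sn hn hF.
  transitivity (H ^+ 2 * (2 / cpsi ^+ 2 * (eps R N * SF) +
                          2 * L ^+ 2 * nf ^+ 2 * (eps R N * Sn))); last by ring.
  by rewrite -hF hn; ring.
rewrite ler_pM2l //; apply: ler_sum_nat => k hk.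
rewrite DdB /=.
rewrite (eq_big_nat _ _ (F2 := fun i : nat => (Dd N u i - b k) ^+ 2)) => [|i hi]; last first.
  by rewrite (vD k) // expr2.
apply: le_trans (sum_sqr_mean_dev _ _ _ (fun i : nat => Dd N u i) _
  (mesh_ltS msh _ hk) (fun i j => Dd_osc k i j hk)) _.
have := Hk_le_Hmax (R := R) (N := N) (idx := idx) k hk; have := Hk_ge0 (R := R) (N := N) (idx := idx) k.
rewrite -/H -/(n k) -/nf -/(F k) => h0 hH.
have -> : n k * (2 / cpsi ^+ 2 * (eps R N ^+ 2 * n k * F k)
                 + 2 * L ^+ 2 * Hk R N idx k ^+ 2 * nf ^+ 2) =
          Hk R N idx k ^+ 2 * (2 / cpsi ^+ 2 * F k + 2 * L ^+ 2 * nf ^+ 2 * n k).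
  by rewrite /Hk -/(n k); ring.
apply: ler_wpM2r; last by rewrite ler_sqr ?nnegrE.
have F0 : 0 <= F k by apply: sumr_ge0 => l _; apply: sqr_ge0.
apply: addr_ge0; first by rewrite mulr_ge0 // mulr_ge0 // invr_ge0 sqr_ge0.
by rewrite mulr_ge0 ?ler0n // mulr_ge0 ?sqr_ge0 // mulr_ge0 ?sqr_ge0.
Qed.

End Regularity.

(** * The cell problem and the HQC form on each element *)

Section Reconstruction.
Context {R : realType} {p N K : nat} {cpsi Cpsi : R} {psi : int -> int -> R}.
Context {idx rep coll : nat -> nat}.
Hypotheses (p0 : (0 < p)%N) (N0 : (0 < N)%N).
Hypotheses (ts : two_scale N p psi) (a1 : A1 cpsi Cpsi psi).
Hypothesis (msh : mesh N K idx).
Implicit Types (u v w : int -> R) (k : nat).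

Local Notation q k := (psi0 p psi (coll k)).
Local Notation psic k := (psi_coll psi coll k).

Lemma psic_gt0 k i : 0 < psic k i.
Proof. exact: (psi_gt0 a1). Qed.

Lemma psic_periodic k : periodic p (psic k).
Proof. by move=> i; rewrite /psi_coll (ts _ _).2. Qed.

Lemma ipRepE k u v : periodic p u -> periodic p v ->
  ipRep p rep k u v = p%:R^-1 * \sum_(1 <= i < p.+1) u i * v i.
Proof.
move=> up vp; rewrite /ipRep; congr (_ * _).
by rewrite (periodic_sum _ (fun i => u i * v i)) // => i; rewrite up vp.
Qed.

Lemma Dd_affD (a b : R) w i :
  Dd N (fun j => a + b * (eps R N * j%:~R) + w j) i = b + Dd N w i.
Proof.
have Nz : N%:R != 0 :> R by rewrite pnatr_eq0 -lt0n.
by rewrite !DdE /eps rmorphD /=; field.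
Qed.

(* [b * chi] is the fluctuation of the reconstruction of an affine function of
   slope [b]: the flux [psi * (1 + D chi)] is the constant [psi0]. *)
Lemma corrector k : exists chi, Upsharp p chi /\
  forall i : nat, (1 <= i <= p)%N -> Dd N chi i = q k / psic k i - 1.
Proof.
apply: periodic_primitive => //.
(* Solvability: the harmonic mean is the one constant for which the prescribed values sum to
   zero. *)
rewrite sumrB -mulr_sumr sumr_const_nat subn1 /= /psi0 /avgY.
set S := \sum_(1 <= i < p.+1) (psi _ _)^-1.
rewrite /psi_coll -/S.
have S0 : S != 0.
  have := harm_gt0 p0 a1 (coll k); rewrite /avgY -/S => h.
  by apply/negP => /eqP E; move: h; rewrite E mulr0 ltxx.
by field; rewrite pnatr_eq0 -lt0n p0 S0.
Qed.

Section Element.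
Context {k : nat}.
Hypothesis hk : (1 <= k <= K)%N.

Lemma recon_specP v r : recon_spec N p psi idx rep coll k v r ->
  exists w, [/\ Upsharp p w, forall i, Dd N r i = Dd N v (idx k) + Dd N w i &
    forall s, Upsharp p s -> ipRep p rep k (fun i => psic k i * Dd N r i) (Dd N s) = 0].
Proof.
move=> [a [b [w [vl [wp [ws ->]]]]]]; exists w; split=> // i.
rewrite Dd_affD; congr (_ + _).
have Nz : N%:R != 0 :> R by rewrite pnatr_eq0 -lt0n.
have := mesh_ltS msh k hk => h.
rewrite DdE !vl; try lia.
by rewrite /eps rmorphD /=; field.
Qed.

(** [recon] is a choice with a default value, so a witness is required: [b * chi] has constant flux
    [b * q k], orthogonal to all difference quotients of periodic functions. *)
Lemma recon_spec_exists v : UHper N K idx v ->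
  recon_spec N p psi idx rep coll k v (recon N p psi idx rep coll k v).
Proof.
move=> [vp vaff]; rewrite /recon.
have [a [b vl]] := vaff k hk.
have [chi [[chip chi0] chiD]] := corrector k.
apply: (@xgetPex _ _ (recon_spec N p psi idx rep coll k v)).
eexists; exists a, b, (fun i => b * chi i); split=> //; split; [|split=> // s [sp s0]].
  by split; [move=> i; rewrite chip | rewrite -mulr_sumr chi0 mulr0].
rewrite ipRepE; last 2 first.
- move=> i; rewrite psic_periodic !Dd_affD; congr (_ * (_ + _)).
  by rewrite !DdE addrAC !chip.
- exact: periodic_Dd.
rewrite (eq_big_nat _ _ (F2 := fun i : nat => b * q k * Dd N s i)) => [|i hi].
  by rewrite -mulr_sumr -add1n sum_Dd // !mulr0.
rewrite Dd_affD; congr (_ * _).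
have -> : Dd N (fun i => b * chi i) i = b * Dd N chi i by rewrite !DdE; ring.
by rewrite chiD //; field; rewrite gt_eqF // psic_gt0.
Qed.

(** Testing the cell problem of [r] with [w'] removes the fluctuation of [r'] and leaves [b'] times
    the total flux [S]; testing with [chi] evaluates [S] as [p * q k * b]. *)
Lemma recon_ip u v r r' :
  recon_spec N p psi idx rep coll k u r -> recon_spec N p psi idx rep coll k v r' ->
  ipRep p rep k (fun i => psic k i * Dd N r i) (Dd N r') =
  q k * Dd N u (idx k) * Dd N v (idx k).
Proof.
move=> /recon_specP[w [[wp w0] rD rs]] /recon_specP[w' [[w'p w'0] r'D _]].
have pz : p%:R != 0 :> R by rewrite pnatr_eq0 -lt0n.
have rp : periodic p (Dd N r) by move=> i; rewrite !rD periodic_Dd.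
have r'p : periodic p (Dd N r') by move=> i; rewrite !r'D periodic_Dd.
have fp : periodic p (fun i => psic k i * Dd N r i).
  by move=> i; rewrite psic_periodic rp.
have [chi [chis chiD]] := corrector k.
have := rs _ chis; have := rs w' (conj w'p w'0).
have chip : periodic p (Dd N chi) by apply: periodic_Dd; case: chis.
have w'Dp : periodic p (Dd N w') by exact: periodic_Dd.
rewrite !ipRepE //.
set b := Dd N u _; set b' := Dd N v _.
pose S := \sum_(1 <= i < p.+1) psic k i * Dd N r i.
have -> : \sum_(1 <= i < p.+1) psic k i * Dd N r i * Dd N chi i = q k * (p%:R * b) - S.
  rewrite (eq_big_nat _ _ (F2 := fun i : nat =>
    q k * (b + Dd N w i) - psic k i * Dd N r i)) => [|i hi].
    rewrite sumrB -/S -mulr_sumr big_split /= sumr_const_nat subn1 /=.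
    by rewrite -[p.+1]add1n (sum_Dd _ _ w) // addr0 -(mulr_natl b).
  by rewrite chiD // rD -/b; field; rewrite gt_eqF // psic_gt0.
have -> : \sum_(1 <= i < p.+1) psic k i * Dd N r i * Dd N r' i =
  b' * S + \sum_(1 <= i < p.+1) psic k i * Dd N r i * Dd N w' i.
  rewrite /S mulr_sumr -big_split /=; apply: eq_bigr => i _.
  by rewrite r'D -/b'; ring.
move=> h1 /eqP h2; rewrite mulrDr h1; move: h2; rewrite mulf_eq0 invr_eq0 (negbTE pz) /=.
rewrite subr_eq0 => /eqP <-.
by field.
Qed.

End Element.

(** Slopes are constant on an element and [Hk] is [eps] times its number of indices, so the sampled
    form is a global inner product with frozen coefficient [al]. *)
Lemma hqc_formE u v : UHper N K idx u -> UHper N K idx v ->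
  forall al : int -> R,
  (forall k (i : nat), (1 <= k <= K)%N -> (idx k <= i < idx k.+1)%N -> al i = q k) ->
  \sum_(1 <= k < K.+1) Hk R N idx k *
    ipRep p rep k (fun i => psic k i * Dd N (recon N p psi idx rep coll k u) i)
                  (Dd N (recon N p psi idx rep coll k v)) =
  ipX N (fun i => al i * Dd N u i) (Dd N v).
Proof.
move=> uH vH al alq.
rewrite /ipX /avgX (mesh_sum msh) mulr_sumr; apply: eq_big_nat => k hk.
rewrite (recon_ip hk _ _ _ _ (recon_spec_exists hk _ uH) (recon_spec_exists hk _ vH)).
rewrite (eq_big_nat _ _ (F2 := fun=> q k * Dd N u (idx k) * Dd N v (idx k))) => [|i hi].
  by rewrite sumr_const_nat -(mulr_natl (_ * _)) /Hk /eps; ring.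
by rewrite (alq k) // (UHper_Dd u k i uH) // (UHper_Dd v k i vH).
Qed.

End Reconstruction.

(** * Strang, Cea and Aubin-Nitsche estimates *)

Section ErrorEstimates.
Context {R : realType} {p N K : nat} {cpsi Cpsi Cpsi' : R} {psi : int -> int -> R}.
Context {idx : nat -> nat} {f u0 : int -> R}.
Hypotheses (p0 : (0 < p)%N) (N0 : (0 < N)%N).
Hypotheses (ts : two_scale N p psi) (a1 : A1 cpsi Cpsi psi) (a2 : A2 N p Cpsi' psi).
Hypotheses (fp : periodic N f) (hu0 : homog_sol N p psi f u0) (msh : mesh N K idx).
Implicit Types (u v w : int -> R).

Let L := Cpsi' / cpsi ^+ 2.
Let CI := 2 / cpsi + 2 * L.
Local Notation H := (Hmax R N K idx).

(** The coefficient and [Dd N w] are both constant on each element, so only the element sums of [d]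
    enter. It applies to the interpolation error, whose difference quotient has zero element
    sums. *)
Lemma ipX_elementwise_orthogonal (al d w : int -> R) : UHper N K idx w ->
  (forall k (i : nat), (1 <= k <= K)%N -> (idx k <= i < idx k.+1)%N ->
    al i = al (idx k)) ->
  (forall k, (1 <= k <= K)%N -> \sum_(idx k <= i < idx k.+1) d i = 0) ->
  ipX N (fun i => al i * d i) (Dd N w) = 0.
Proof.
move=> wH alk d0; rewrite /ipX /avgX (mesh_sum msh) big1_seq ?mulr0 // => k.
rewrite mem_index_iota => /= hk.
rewrite (eq_big_nat _ _ (F2 := fun i : nat => al (idx k) * Dd N w (idx k) * d i)) => [|i hi].
  by rewrite -mulr_sumr d0 // mulr0.
by rewrite (alk k) // (UHper_Dd w k i wH) //; ring.
Qed.

Lemma Lip_ge0 : 0 <= L.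
Proof. by rewrite divr_ge0 ?(Cpsi'_ge0 a2) ?sqr_ge0. Qed.

Lemma CI_ge0 : 0 <= CI.
Proof.
have c0 : 0 < cpsi^-1 by rewrite invr_gt0 (cpsi_gt0 a1).
have := Lip_ge0; rewrite /CI; lra.
Qed.

Lemma ipX_psi0_le u v :
  ipX N (fun i => psi0 p psi i * Dd N u i) (Dd N v) <=
  Cpsi * L2norm N (Dd N u) * L2norm N (Dd N v).
Proof.
apply: ipX_coef_le => [|i hi]; first exact/ltW/(Cpsi_gt0 a1).
have /andP[h1 h2] := psi0_bounds p0 a1 i; rewrite ger0_norm //.
exact: le_trans (ltW (cpsi_gt0 a1)) h1.
Qed.

Lemma hqc_H1_error rep coll uH : sampling p K idx rep coll ->
  hqc_sol N p psi f K idx rep coll uH ->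
  H1semi N (uH \- u0) <= (Cpsi ^+ 2 * L / cpsi ^+ 2 + CI) * H * L2norm N f.
Proof.
move=> smp [uHs huH].
have c0 := cpsi_gt0 a1.
have [loc locP] := mesh_locate msh.
pose al (i : int) : R := psi0 p psi (coll (loc (absz i))).
have alE k (i : nat) : (1 <= k <= K)%N -> (idx k <= i < idx k.+1)%N ->
    al i = psi0 p psi (coll k).
  by move=> hk hi; rewrite /al absz_nat (locP k).
have [I [Is I0 Ierr]] := interpolation_error p0 N0 ts a1 a2 fp hu0 msh.
pose v := uH \- I.
have vs : UHsharp N K idx v by exact: UHsharpB.
set nf := L2norm N f in Ierr *; have nf0 : 0 <= nf := L2norm_ge0 N f.
have H0 : 0 <= H := Hmax_ge0.
have consistency : ipX N (fun i => al i * Dd N v i) (Dd N v) =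
    ipX N (fun i => (psi0 p psi i - al i) * Dd N u0 i) (Dd N v).
  have h1 : ipX N (fun i => al i * Dd N uH i) (Dd N v) =
            ipX N (fun i => psi0 p psi i * Dd N u0 i) (Dd N v).
    rewrite -(hqc_formE (rep := rep) p0 N0 ts a1 msh uH v uHs.1 vs.1 al alE) huH //.
    by rewrite hu0.2 //; exact: vs.1.1.
  have h2 : ipX N (fun i => al i * Dd N (u0 \- I) i) (Dd N v) = 0.
    apply: ipX_elementwise_orthogonal => //; first exact: vs.1.
    move=> k i hk hi; rewrite !(alE k) // leqnn /=; exact: mesh_ltS msh _ hk.
  rewrite (_ : (fun i => al i * Dd N v i) =
    (fun i => al i * Dd N uH i) \- (fun i => al i * Dd N u0 i)
    \+ (fun i => al i * Dd N (u0 \- I) i)); last first.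
    by apply/funext => i /=; rewrite /v !DdB /=; ring.
  rewrite ipXDl ipXBl h1 h2 addr0 -ipXBl; congr (ipX N _ _).
  by apply/funext => i /=; ring.
have al_close (i : nat) : (1 <= i <= N)%N ->
    `|psi0 p psi i - al i| <= Cpsi ^+ 2 * L * H.
  move=> /(mesh_cover msh)[k /andP[hk hi]]; rewrite (alE k) //.
  have [hr [hr' hc]] := smp k hk.
  (* The collocation point lies in the same element as [i], so freezing costs at most the Lipschitz
     constant times [Hk]. *)
  have hck : (idx k <= coll k < idx k.+1)%N by lia.
  have [r1 r2] := mesh_bounds msh k hk.
  apply: le_trans (psi0_lip p0 N0 a1 a2 _ _ _ _ r1 r2 hi hck) _.
  apply: ler_wpM2l; first by rewrite mulr_ge0 ?sqr_ge0 ?Lip_ge0.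
  exact: Hk_le_Hmax.
have vbound : L2norm N (Dd N v) <= Cpsi ^+ 2 * L * H * (nf / cpsi) / cpsi.
  have M0 : 0 <= Cpsi ^+ 2 * L * H by rewrite mulr_ge0 // mulr_ge0 ?sqr_ge0 ?Lip_ge0.
  apply: (@ipX_coercive _ N al) => //.
  - move=> i /(mesh_cover msh)[k /andP[hk hi]]; rewrite (alE k) //.
    by case/andP: (psi0_bounds p0 a1 (coll k)).
  - rewrite consistency; apply: le_trans (ipX_coef_le _ _ _ _ _ M0 al_close) _.
    apply: ler_wpM2r (L2norm_ge0 _ _) _ _ _; apply: ler_wpM2l => //.
    exact: (homog_energy p0 N0 ts a1 fp hu0).
  - by rewrite mulr_ge0 // divr_ge0 // ltW.
rewrite /H1semi (_ : Dd N (uH \- u0) = Dd N v \+ (fun i => - Dd N (u0 \- I) i)); last first.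
  by apply/funext => i /=; rewrite /v !DdB /=; ring.
apply: le_trans (L2normD _ _ _) _.
have -> : L2norm N (fun i => - Dd N (u0 \- I) i) = L2norm N (Dd N (u0 \- I)).
  by rewrite /L2norm; congr Num.sqrt; apply: eq_ipX => i _; rewrite mulrNN.
have -> : (Cpsi ^+ 2 * L / cpsi ^+ 2 + CI) * H * nf =
   Cpsi ^+ 2 * L * H * (nf / cpsi) / cpsi + CI * H * nf.
  by field; rewrite gt_eqF.
exact: lerD.
Qed.

Lemma galerkin_orthogonality t w : galerkin_sol N p psi f K idx t ->
  UHsharp N K idx w ->
  ipX N (fun i => psi0 p psi i * Dd N (t \- u0) i) (Dd N w) = 0.
Proof.
move=> [_ ht] ws.
rewrite (_ : (fun i => _) = (fun i => psi0 p psi i * Dd N t i) \-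
                            (fun i => psi0 p psi i * Dd N u0 i)); last first.
  by apply/funext => i /=; rewrite DdB /=; ring.
by rewrite ipXBl ht // hu0.2 ?subrr //; exact: ws.1.1.
Qed.

Lemma galerkin_H1_error t : galerkin_sol N p psi f K idx t ->
  L2norm N (Dd N (t \- u0)) <= Cpsi / cpsi * CI * H * L2norm N f.
Proof.
move=> ht.
have c0 := cpsi_gt0 a1; have C0 := ltW (Cpsi_gt0 a1).
have [I [Is I0 Ierr]] := interpolation_error p0 N0 ts a1 a2 fp hu0 msh.
have nf0 := L2norm_ge0 N f.
have CI0 := CI_ge0.
have H0 : 0 <= H := Hmax_ge0.
have -> : Cpsi / cpsi * CI * H * L2norm N f = Cpsi * (CI * H * L2norm N f) / cpsi.
  by ring.
apply: (@ipX_coercive _ N (psi0 p psi)) => //; last by rewrite !mulr_ge0.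
  by move=> i _; case/andP: (psi0_bounds p0 a1 i).
(* By Galerkin orthogonality the second slot may be changed by [t \- I], a mesh function. *)
have -> : ipX N (fun i => psi0 p psi i * Dd N (t \- u0) i) (Dd N (t \- u0)) =
          ipX N (fun i => psi0 p psi i * Dd N (t \- u0) i) (Dd N (I \- u0)).
  apply/eqP; rewrite -subr_eq0 -ipXBr -DdB; apply/eqP.
  rewrite (_ : t \- u0 \- (I \- u0) = t \- I); last by apply/funext => i /=; ring.
  by apply: galerkin_orthogonality => //; apply: UHsharpB => //; case: ht.
apply: le_trans (ipX_psi0_le _ _) _.
rewrite mulrAC; apply: ler_wpM2r; first exact: L2norm_ge0.
apply: ler_wpM2l => //.
rewrite (_ : L2norm N (Dd N (I \- u0)) = L2norm N (Dd N (u0 \- I))) //.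
rewrite /L2norm; congr Num.sqrt; apply: eq_ipX => i _.
by rewrite !DdB /=; ring.
Qed.

Lemma galerkin_L2_error t : galerkin_sol N p psi f K idx t ->
  L2norm N (t \- u0) <= Cpsi ^+ 2 / cpsi * CI ^+ 2 * H ^+ 2 * L2norm N f.
Proof.
move=> ht; set e := t \- u0.
have C0 := ltW (Cpsi_gt0 a1).
have [[[tp _] t0] [up u00]] : UHsharp N K idx t /\ UNsharp N u0 by split; [case: ht|case: hu0].
have ep : periodic N e by move=> i; rewrite /e /= tp up.
have e0 : avgX N e = 0.
  by rewrite /avgX /e sumrB mulrBr; move: t0 u00; rewrite /avgX => -> ->; rewrite subrr.
(* The form is symmetric, so the dual problem is the homogenized problem with data [e], which is
   periodic with zero mean. *)
have [phi hphi] := homog_exists p0 N0 a1 _ ep e0.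
have [J [Js _ Jerr]] := interpolation_error p0 N0 ts a1 a2 ep hphi msh.
have H0 : 0 <= H := Hmax_ge0.
have CI0 := CI_ge0.
have key : L2norm N e ^+ 2 <=
    (Cpsi ^+ 2 / cpsi * CI ^+ 2 * H ^+ 2 * L2norm N f) * L2norm N e.
  rewrite sqr_L2norm -hphi.2 //.
  have -> : ipX N (fun i => psi0 p psi i * Dd N phi i) (Dd N e) =
            ipX N (fun i => psi0 p psi i * Dd N e i) (Dd N (phi \- J)).
    rewrite [in RHS]DdB ipXBr (galerkin_orthogonality t J ht Js) subr0.
    by apply: eq_ipX => i _; ring.
  apply: le_trans (ipX_psi0_le _ _) _.
  (* One factor [H] comes from the energy error of [t], the other from interpolating [phi]; the norm
     of the data [e] is then cancelled. *)
  have -> : Cpsi ^+ 2 / cpsi * CI ^+ 2 * H ^+ 2 * L2norm N f * L2norm N e =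
    Cpsi * (Cpsi / cpsi * CI * H * L2norm N f) * (CI * H * L2norm N e) by ring.
  apply: ler_pM => //; rewrite ?mulr_ge0 ?L2norm_ge0 //.
  by apply: ler_wpM2l => //; exact: galerkin_H1_error.
have := L2norm_ge0 N e; rewrite le_eqVlt => /orP[/eqP <-|en0].
  by rewrite !mulr_ge0 ?sqr_ge0 ?L2norm_ge0 // invr_ge0 ltW // (cpsi_gt0 a1).
by rewrite -(ler_pM2r en0) -expr2.
Qed.

End ErrorEstimates.

Theorem theorem6p1 (R : realType) (p : nat) (cpsi Cpsi Cpsi' : R) :
  (0 < p)%N ->
  exists C4 C5 : R,
    forall (N : nat) (psi : int -> int -> R) (f : int -> R)
           (K : nat) (idx rep coll : nat -> nat) (u0 uH tuH : int -> R),
      (0 < N)%N ->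
      two_scale N p psi -> A1 cpsi Cpsi psi -> A2 N p Cpsi' psi ->
      periodic N f -> avgX N f = 0 ->
      mesh N K idx -> sampling p K idx rep coll ->
      homog_sol N p psi f u0 ->
      hqc_sol N p psi f K idx rep coll uH ->
      galerkin_sol N p psi f K idx tuH ->
      H1semi N (uH \- u0) <= C4 * Hmax R N K idx * L2norm N f /\
      L2norm N (uH \- u0) <= C5 * Hmax R N K idx ^+ 2 * L2norm N f
                             + L2norm N (uH \- tuH).
Proof.
move=> p0; pose L := Cpsi' / cpsi ^+ 2; pose CI := 2 / cpsi + 2 * L.
(* The Strang constant and the Aubin-Nitsche constant, fixed before the grid, the mesh and the data
   are introduced. *)
exists (Cpsi ^+ 2 * L / cpsi ^+ 2 + CI), (Cpsi ^+ 2 / cpsi * CI ^+ 2).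
move=> N psi f K idx rep coll u0 uH tuH N0 ts a1 a2 fp _ msh smp hu0 huH htuH.
split; first exact: (hqc_H1_error p0 N0 ts a1 a2 fp hu0 msh rep coll uH smp huH).
rewrite (_ : uH \- u0 = tuH \- u0 \+ (uH \- tuH)); last by apply/funext => i /=; ring.
apply: le_trans (L2normD _ _ _) _; rewrite lerD2r.
exact: (galerkin_L2_error p0 N0 ts a1 a2 fp hu0 msh tuH htuH).
Qed.
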